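(* Let $A$ be a densely defined closed antilinear operator from a complex Hilbert space $\mathcal{H}_1$ into a complex Hilbert space $\mathcal{H}_2$. Then $A^\dagger A$ and $AA^\dagger$ are positive self-adjoint (linear) operators on $\mathcal{H}_1$ and $\mathcal{H}_2$, respectively. Moreover, $\mathcal{D}(A^\dagger A)$ is a core for the operator $A$.
   Context: Scalar products are linear in the first variable. Operators may be unbounded; products have their natural domains. An operator $A$ on a linear subspace $\mathcal{D}(A)\subseteq\mathcal{H}_1$ is antilinear if $A(\alpha x+\beta y)=\overline{\alpha}\,Ax+\overline{\beta}\,Ay$ for $\alpha,\beta\in\mathbb{C}$, $x,y\in\mathcal{D}(A)$. For a densely defined antilinear $A:\mathcal{H}_1\to\mathcal{H}_2$, the adjoint $A^\dagger:\mathcal{H}_2\to\mathcal{H}_1$ is the antilinear operator whose domain consists of all $y\in\mathcal{H}_2$ for which there is $u\in\mathcal{H}_1$ with $\langle Ax,y\rangle=\langle u,x\rangle$ for all $x\in\mathcal{D}(A)$; then $A^\dagger y:=u$. Positive means $\langle Bx,x\rangle\ge 0$ for all $x$ in the domain of $B$. A core for a closed operator $A$ is a linear subspace of $\mathcal{D}(A)$ that is dense in $\mathcal{D}(A)$ with respect to the graph norm. *)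

(* Defs.v *)
From HB Require Import structures.
From mathcomp Require Import all_boot all_order all_algebra.
From mathcomp Require Import complex.
From mathcomp Require Import all_classical all_reals all_analysis.

Set Implicit Arguments.
Unset Strict Implicit.
Unset Printing Implicit Defensive.

Import Order.TTheory GRing.Theory Num.Theory.
Import numFieldNormedType.Exports.

Local Open Scope classical_set_scope.
Local Open Scope ring_scope.

(* [{dot H for conjC}] is linear in its first variable and conjugate-linear in
   its second; the norm of [H], hence [hdot x x], takes its values in [R[i]]. *)
HB.mixin Record CompleteNormedModule_isHilbert (R : realType) H
    of CompleteNormedModule R[i] H := {
  hdot : {dot H for (@Num.conj R[i])} ;
  hnormE : forall x : H, `|x| ^+ 2 = hdot x x
}.

#[short(type="hilbertType")]
HB.structure Definition Hilbert (R : realType) :=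
  {H of CompleteNormedModule_isHilbert R H & CompleteNormedModule R[i] H}.

Local Notation "''[' x , y ]" := (hdot x y) : ring_scope.

Section Operators.
Context {R : realType}.
Implicit Types H K : hilbertType R.

(* A partially defined map: the values of [op] outside of [dom] are junk,
   which is why operators are compared with [op_eq] rather than [=]. *)
Record operator H K := Operator { dom : set H ; op :> H -> K }.

Definition op_eq H K (S T : operator H K) : Prop :=
  dom S = dom T /\ forall x, dom T x -> S x = T x.

Definition linear_op H K (T : operator H K) : Prop :=
  submod_closed (mem (dom T)) /\
  forall (a b : R[i]) (x y : H), dom T x -> dom T y ->
    T (a *: x + b *: y) = a *: T x + b *: T y.

Definition antilinear_op H K (T : operator H K) : Prop :=
  submod_closed (mem (dom T)) /\
  forall (a b : R[i]) (x y : H), dom T x -> dom T y ->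
    T (a *: x + b *: y) = a^* *: T x + b^* *: T y.

Definition densely_defined H K (T : operator H K) : Prop := dense (dom T).

Definition closed_op H K (T : operator H K) : Prop :=
  closed [set p : H * K | dom T p.1 /\ p.2 = T p.1].

Definition comp_op H K L (S : operator K L) (T : operator H K) : operator H L :=
  Operator [set x | dom T x /\ dom S (T x)] (S \o T).

(* In both adjoints the vector [u] is unique as soon as [T] is densely defined;
   [xget] only turns it into a function of [y]. *)
Definition adjoint H K (T : operator H K) : operator K H :=
  let P y := [set u : H | forall x, dom T x -> '[T x, y] = '[x, u]] in
  Operator [set y | P y !=set0] (fun y => xget 0 (P y)).

Definition antiadjoint H K (T : operator H K) : operator K H :=
  let P y := [set u : H | forall x, dom T x -> '[T x, y] = '[u, x]] in
  Operator [set y | P y !=set0] (fun y => xget 0 (P y)).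

Definition self_adjoint H (T : operator H H) : Prop :=
  densely_defined T /\ op_eq (adjoint T) T.

(* [0 <= z] in [R[i]] means that [z] is real and nonnegative. *)
Definition positive_op H (T : operator H H) : Prop :=
  forall x, dom T x -> 0 <= '[T x, x].

Definition graph_norm H K (T : operator H K) (x : H) : R[i] :=
  sqrtC (`|x| ^+ 2 + `|T x| ^+ 2).

Definition core H K (T : operator H K) (D : set H) : Prop :=
  [/\ submod_closed (mem D), D `<=` dom T &
      forall x, dom T x -> forall e : R[i], 0 < e ->
        exists2 y, D y & graph_norm T (x - y) < e].

End Operators.

(* Main.v *)
Require Import Defs.
From HB Require Import structures.
From mathcomp Require Import all_boot all_order all_algebra.
From mathcomp Require Import complex.
From mathcomp Require Import all_classical all_reals all_analysis.
From mathcomp Require Import ring lra.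

(** Since [A] is antilinear, its graph is only a real subspace of [H1 * H2]
    that is closed for the real inner product
    [Re '[x, x'] + Re '[y, y']]. Projecting [(h, k)] orthogonally onto it yields
    [x] in [dom A] and [w] in [dom A^dagger] with [h = x - A^dagger w] and
    [k = A x + w] (multiplying test vectors by ['i] turns real orthogonality
    into the complex adjoint relation). Taking [k = 0], resp. [h = 0], shows
    that [1 + A^dagger A] and [1 + A A^dagger] are onto; for a positive
    symmetric operator, surjectivity of [1 + T] gives a dense domain and
    self-adjointness. In particular [A^{dagger dagger} = A] is never needed.
    If [(z, A z)] is orthogonal to the graph of [A] restricted to
    [dom (A^dagger A)], then [z] is orthogonal to the range of
    [1 + A^dagger A], so [z = 0]: this is the core property. *)

Set Implicit Arguments.
Unset Strict Implicit.
Unset Printing Implicit Defensive.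

Import Order.TTheory GRing.Theory Num.Theory.
Import numFieldNormedType.Exports.

Local Open Scope classical_set_scope.
Local Open Scope ring_scope.
Local Open Scope complex_scope.

Local Notation "''[' x , y ]" := (hdot x y) : ring_scope.

(** * The real inner product underlying a complex Hilbert space *)

Section InnerProduct.
Context {R : realType} {H : hilbertType R}.
Implicit Types x y z : H.

Lemma hdotC x y : '[x, y] = Num.conj '[y, x].
Proof. by rewrite hermC expr0 mul1r. Qed.

Lemma hdot_inj x y : (forall z, '[z, x] = '[z, y]) -> x = y.
Proof.
move=> xy; apply/eqP; rewrite -subr_eq0 -(dnorm_eq0 hdot); apply/eqP.
by rewrite linearBr /= xy subrr.
Qed.

Definition rdot x y : R := complex.Re '[x, y].

Lemma ReD (a b : R[i]) : complex.Re (a + b) = complex.Re a + complex.Re b.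
Proof. by case: a b => ? ? []. Qed.

Lemma rdotC x y : rdot x y = rdot y x.
Proof. by rewrite /rdot hdotC; case: '[y, x]. Qed.

Lemma rdotDl x y z : rdot (x + y) z = rdot x z + rdot y z.
Proof. by rewrite /rdot linearDl ReD. Qed.

Lemma rdotZl (r : R) x z : rdot (r%:C *: x) z = r * rdot x z.
Proof.
by rewrite /rdot linearZl_LR /=; case: '[x, z] => a b /=; rewrite mul0r subr0.
Qed.

Lemma hdotxx x : '[x, x] = (rdot x x)%:C.
Proof. by rewrite RRe_real// ger0_real// dnorm_ge0. Qed.

Lemma rdot_ge0 x : 0 <= rdot x x.
Proof. by rewrite -ler0c -hdotxx dnorm_ge0. Qed.

Lemma rdot_eq0 x : rdot x x = 0 -> x = 0.
Proof. by move=> x0; apply/eqP; rewrite -(dnorm_eq0 hdot) hdotxx x0. Qed.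

Lemma norm_sqr_rdot x : `|x| ^+ 2 = (rdot x x)%:C.
Proof. by rewrite hnormE hdotxx. Qed.

Lemma rdot_lt_norm (e : R) x : 0 < e -> rdot x x < e ^+ 2 -> `|x| < e%:C.
Proof.
move=> e0 xe; rewrite -(@ltr_pXn2r _ 2)// ?nnegrE ?ler0c ?(ltW e0)//.
by rewrite norm_sqr_rdot -rmorphXn ltcR.
Qed.

Lemma norm_lt_rdot (e : R) x : `|x| < e%:C -> rdot x x < e ^+ 2.
Proof.
move=> xe; rewrite -ltcR -norm_sqr_rdot rmorphXn/=.
by rewrite ltr_pXn2r// ?nnegrE// (le_trans _ (ltW xe)).
Qed.

End InnerProduct.

(** * Orthogonal projection in a product of two Hilbert spaces *)

Section Projection.
Context {R : realType} {H K : hilbertType R}.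
Implicit Types p q m u v w : H * K.

(** The real inner product of the Hilbert direct sum. The topology of [H * K] comes from the maximum
    norm; [pair_cauchy_cvg] and [cvg_pdot] translate between the two. *)
Definition pdot p q : R := rdot p.1 q.1 + rdot p.2 q.2.

Lemma pdotC p q : pdot p q = pdot q p.
Proof. by congr (_ + _); exact: rdotC. Qed.

Lemma pdotDl u v w : pdot (u + v) w = pdot u w + pdot v w.
Proof. by rewrite /pdot !rdotDl addrACA. Qed.

Lemma pdotZl (r : R) u w : pdot (r%:C *: u) w = r * pdot u w.
Proof. by rewrite /pdot !rdotZl mulrDr. Qed.

Lemma pdot_ge0 u : 0 <= pdot u u.
Proof. by rewrite addr_ge0// rdot_ge0. Qed.

Lemma pdot_sqrDZ (t : R) u v :
  pdot (u + t%:C *: v) (u + t%:C *: v)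
  = pdot u u + 2 * t * pdot u v + t ^+ 2 * pdot v v.
Proof.
rewrite pdotDl pdotZl !(pdotC _ (u + _)) !pdotDl !pdotZl (pdotC v u); ring.
Qed.

Lemma pdot_parallelogram u v :
  pdot (u - v) (u - v) = 2 * pdot u u + 2 * pdot v v - pdot (u + v) (u + v).
Proof.
have -> : u - v = u + (- 1)%:C *: v by rewrite rmorphN1 scaleN1r.
have -> : u + v = u + 1%:C *: v by rewrite rmorph1 scale1r.
by rewrite !pdot_sqrDZ; ring.
Qed.

(** Once [e] tends to 0, a term linear in [t] is bounded by a quadratic one for all [t] of either
    sign, which forces its coefficient to vanish. *)
Lemma dominated_eq0 (c b : R) :
  (forall t e, 0 < e -> 2 * t * c <= e + t ^+ 2 * b) -> c = 0.
Proof.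
move=> h.
have b0 : 0 <= b.
  apply/ler_addgt0Pl => e e0; have := h 1 (e / 2); have := h (-1) (e / 2).
  by move=> /(_ ltac:(lra)) ? /(_ ltac:(lra)); lra.
have k t : 2 * t * c <= t ^+ 2 * b.
  by apply/ler_addgt0Pl => e e0; apply: h.
(* The shift by 1 keeps the denominator positive when [b = 0]; this [t] yields
   [c ^+ 2 / (b + 1) ^+ 2 * (b + 2) <= 0]. *)
have := k (c / (b + 1)).
have -> : 2 * (c / (b + 1)) * c = c ^+ 2 / (b + 1) ^+ 2 * (2 * (b + 1)).
  by field; lra.
have -> : (c / (b + 1)) ^+ 2 * b = c ^+ 2 / (b + 1) ^+ 2 * b.
  by field; lra.
rewrite -subr_le0 -mulrBr => h'.
have q0 : 0 <= c ^+ 2 / (b + 1) ^+ 2 by rewrite divr_ge0// sqr_ge0.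
have /eqP : c ^+ 2 / (b + 1) ^+ 2 = 0 by nra.
rewrite mulf_eq0 invr_eq0 !sqrf_eq0 => /orP[/eqP//|/eqP]; lra.
Qed.

Lemma pair_cauchy_cvg (u : nat -> H * K) :
  (forall e : R, 0 < e -> exists N, forall n, (N <= n)%N ->
     pdot (u N - u n) (u N - u n) < e) ->
  exists q, u @ \oo --> q.
Proof.
move=> uC.
have cvgu (L : hilbertType R) (f : H * K -> L) :
    (forall x y, f (x - y) = f x - f y) ->
    (forall x, rdot (f x) (f x) <= pdot x x) -> cvg (f (u n) @[n --> \oo]).
  move=> fB fle; apply: cauchy_cvg; apply: cauchy_exP => eps eps0.
  have [e E] : exists e : R, eps = e%:C.
    by exists (complex.Re eps); rewrite RRe_real// gtr0_real.
  move: eps0; rewrite E ltcR => e0.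
  have [N uN] := uC (e ^+ 2) (exprn_gt0 2 e0).
  exists (f (u N)); exists N => // n /= Nn.
  rewrite -ball_normE /= -fB; apply: rdot_lt_norm => //.
  exact: le_lt_trans (fle _) (uN _ Nn).
have c1 : cvg ((u n).1 @[n --> \oo]).
  by apply: (cvgu H fst) => // x; rewrite lerDl rdot_ge0.
have c2 : cvg ((u n).2 @[n --> \oo]).
  by apply: (cvgu K snd) => // x; rewrite lerDr rdot_ge0.
exists (lim ((u n).1 @[n --> \oo]), lim ((u n).2 @[n --> \oo])).
have -> : u = fun n => ((u n).1, (u n).2).
  by apply/funext => n; exact: surjective_pairing.
exact: cvg_pair c1 c2.
Qed.

Lemma cvg_pdot (u : nat -> H * K) q : u @ \oo --> q ->
  forall e : R, 0 < e -> \forall n \near \oo, pdot (u n - q) (u n - q) < e.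
Proof.
move=> uq e e0.
have d0 : 0 < Num.sqrt (e / 2) by rewrite sqrtr_gt0; lra.
have := cvg_ball uq (_ : 0 < (Num.sqrt (e / 2))%:C).
rewrite ltcR => /(_ _ d0); apply: filterS => n [].
rewrite -!ball_normE /= !(distrC q.1) !(distrC q.2).
move=> /norm_lt_rdot h1 /norm_lt_rdot h2.
rewrite !sqr_sqrtr in h1 h2; [|lra..].
rewrite /pdot; lra.
Qed.

(** A sequence in [M] minimizing the distance to [p] is Cauchy by the parallelogram law; its limit
    lies in the closure of [M], and minimality makes [p - q] orthogonal to [M]. *)
Lemma closure_projection (M : set (H * K)) p : M 0 ->
  (forall (r : R) u v, M u -> M v -> M (r%:C *: u + v)) ->
  exists2 q, closure M q & forall m, M m -> pdot (p - q) m = 0.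
Proof.
move=> M0 ML.
pose D := [set pdot (p - m) (p - m) | m in M].
have D0 : D !=set0 by exists (pdot (p - 0) (p - 0)); exists 0.
have Dlb : lbound D 0 by move=> _ [m _ <-]; exact: pdot_ge0.
have dle m : M m -> inf D <= pdot (p - m) (p - m).
  by move=> Mm; apply: ge_inf; [exists 0 | exists m].
have [eps [eps0 small]] : exists eps : nat -> R, (forall n, 0 < eps n) /\
    forall e, 0 < e -> exists N, forall n, (N <= n)%N -> eps n < e.
  exists (fun n => n.+1%:R^-1); split=> [n|e e0]; first by rewrite invr_gt0.
  have [N _ NP] := near_infty_natSinv_lt (PosNum e0).
  by exists N => n Nn; apply: NP.
have [u uP] : {u : nat -> H * K &
    forall n, M (u n) /\ pdot (p - u n) (p - u n) < inf D + eps n}.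
  apply: (choice (P := fun n m => M m /\ pdot (p - m) (p - m) < inf D + eps n)).
  move=> n; have [] := inf_adherent (eps0 n) (E := D).
    by split => //; exists 0.
  by move=> _ [m Mm <-] ?; exists m.
have uM n : M (u n) by case: (uP n).
have ue n : pdot (p - u n) (p - u n) < inf D + eps n by case: (uP n).
(* The sum is twice the vector from the midpoint of [u n] and [u k] to [p], and that midpoint lies
   in [M]. *)
have midpoint n k :
    4 * inf D <= pdot ((p - u n) + (p - u k)) ((p - u n) + (p - u k)).
  have -> : (p - u n) + (p - u k)
      = 2%:C *: (p - ((2^-1)%:C *: (1%:C *: u n + u k) + 0)).
    rewrite addr0 [1%:C]rmorph1 [1 *: _]scale1r scalerBr scalerA -rmorphM.
    rewrite mulfV ?pnatr_eq0// rmorph1 scale1r.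
    by rewrite rmorph_nat scaler_nat mulr2n opprD addrACA.
  rewrite pdotZl pdotC pdotZl mulrA -natrM ler_pM2l//.
  by apply/dle/(ML) => //; apply/(ML).
have [q uq] : exists q, u @ \oo --> q.
  apply: pair_cauchy_cvg => e e0.
  (* The parallelogram law and [midpoint] bound the squared distance by [2 * eps n + 2 * eps N]. *)
  have [N NP] := small (e / 4) ltac:(lra).
  exists N => n Nn; have -> : u N - u n = (p - u n) - (p - u N).
    by rewrite opprB [RHS]addrC subrKA.
  rewrite pdot_parallelogram.
  have := NP _ Nn; have := NP _ (leqnn N).
  move: (midpoint n N) (ue n) (ue N) => *. lra.
exists q.
  apply: (closed_cvg (closure M)) uq; first exact: closed_closure.
  by apply: nearW => n; apply: subset_closure.
move=> m Mm; apply: (@dominated_eq0 _ (2 * pdot m m)) => t e e0.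
have [N NP] := small (e / 2) ltac:(lra).
have [k _ kP] := cvg_pdot uq (e := e / 2) ltac:(lra).
pose n := maxn N k.
have := NP n (leq_maxl _ _); have := kP n (leq_maxr _ _); have := ue n.
(* Near-minimality of [u n] along [u n + t m], together with
   [0 <= |(u n - q) - t m|^2], gives both halves of the bound. *)
have := dle (t%:C *: m + u n) (ML _ _ _ Mm (uM n)).
have -> : p - (t%:C *: m + u n) = (p - u n) + (- t)%:C *: m.
  by rewrite rmorphN scaleNr opprD addrA addrAC.
have := pdot_ge0 ((u n - q) + (- t)%:C *: m).
rewrite !pdot_sqrDZ.
have -> : pdot (p - q) m = pdot (p - u n) m + pdot (u n - q) m.
  by rewrite -pdotDl subrKA.
move=> *; nra.
Qed.
End Projection.

(** * Density and orthogonality *)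

Section Density.
Context {R : realType} {H : hilbertType R}.
Implicit Types (D : set H) (x y : H).

Lemma closure_rdotP D x :
  closure D x <-> forall e : R, 0 < e -> exists2 y, D y & rdot (x - y) (x - y) < e.
Proof.
split=> [Dx e e0|Dx B].
  have d0 : 0 < Num.sqrt e by rewrite sqrtr_gt0.
  have [|y [Dy]] := Dx (ball x (Num.sqrt e)%:C).
    by apply: nbhsx_ballx; rewrite ltcR.
  rewrite -ball_normE => /norm_lt_rdot; rewrite sqr_sqrtr ?ltW// => yx.
  by exists y.
move=> /nbhs_ballP[e /= e0 eB].
have eE : e = (complex.Re e)%:C by rewrite RRe_real// gtr0_real.
have r0 : 0 < complex.Re e by rewrite -ltcR -eE.
have [y Dy yx] := Dx _ (exprn_gt0 2 r0); exists y; split=> //; apply: eB.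
by rewrite -ball_normE /= eE; apply: rdot_lt_norm.
Qed.

Lemma dense_closure D : dense D <-> forall x, closure D x.
Proof.
split=> [Dd x B|Dx O [x Ox] oO].
  rewrite nbhsE => -[U [oU Ux] UB].
  by have [y [Uy Dy]] := Dd U (ex_intro _ x Ux) oU; exists y; split=> //; apply: UB.
have [|y [Dy Oy]] := Dx x O; first exact: open_nbhs_nbhs.
by exists y.
Qed.

(** By Pythagoras the squared distance from [x] to any [y] in [D] is at least [rdot x x], while
    density makes it arbitrarily small. *)
Lemma dense_orthogonal D x : dense D -> (forall y, D y -> '[x, y] = 0) -> x = 0.
Proof.
move=> /dense_closure/(_ x)/closure_rdotP Dx xD; apply: rdot_eq0.
apply/eqP; rewrite eq_le rdot_ge0 andbT; apply/ler_addgt0Pl => e e0.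
have [y Dy yx] := Dx _ e0; rewrite addr0.
have xy0 : rdot y x = 0 by rewrite rdotC /rdot xD.
move: yx (rdot_ge0 y); rewrite -scaleN1r -[-1](@rmorphN1 _ _ (real_complex R)).
by rewrite rdotDl rdotZl !(rdotC _ (x + _)) !rdotDl !rdotZl xy0 (rdotC x y) xy0; lra.
Qed.

Lemma dense_of_orthogonal D : D 0 ->
  (forall (a : R[i]) x y, D x -> D y -> D (a *: x + y)) ->
  (forall x, (forall y, D y -> rdot x y = 0) -> x = 0) -> dense D.
Proof.
move=> D0 DL Dorth; apply/dense_closure => x.
(* To project inside a single space, [D] is embedded in [H * H] with second coordinate 0. *)
have [|r u v [Du u2] [Dv v2]|q qD xq] :=
  @closure_projection R H H [set p | D p.1 /\ p.2 = 0] (x, 0); first by [].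
  by split; [exact: DL | rewrite /= u2 v2 scaler0 addr0].
have -> : x = q.1.
  apply/eqP; rewrite -subr_eq0; apply/eqP/Dorth => y Dy.
  have := xq (y, 0) (conj Dy erefl).
  by rewrite /pdot /= [X in _ + X](_ : _ = 0) ?addr0// /rdot linear0r.
move=> B qB; have [|[y z] [[/= Dy _] yB]] := qD (fst @^-1` B).
  exact: (cvg_fst qB).
by exists y.
Qed.

End Density.

(** * Antilinear operators, their adjoints, and a self-adjointness criterion *)

Section Operators.
Context {R : realType}.
Implicit Types H K L : hilbertType R.

Lemma submod_closedP H (D : set H) :
  submod_closed (mem D) <->
  D 0 /\ forall (a : R[i]) x y, D x -> D y -> D (a *: x + y).
Proof.
have E z : z \in mem D <-> D z by split=> /asboolP.
split=> [[/E D0 DL]|[D0 DL]]; split=> //.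
- by move=> a x y /E Dx /E Dy; apply/E/DL.
- exact/E.
- by move=> a x y /E Dx /E Dy; apply/E/DL.
Qed.

Lemma dom_lin H K (T : operator H K) (a b : R[i]) x y :
  submod_closed (mem (dom T)) -> dom T x -> dom T y -> dom T (a *: x + b *: y).
Proof.
move=> /submod_closedP[D0 DL] Dx Dy; apply: (DL) => //.
by rewrite -[_ *: _]addr0; apply: DL.
Qed.

Lemma antilinear0 H K (T : operator H K) : antilinear_op T -> T 0 = 0.
Proof.
move=> [/submod_closedP[T0 _] TL].
by have := TL 0 0 0 0 T0 T0; rewrite rmorph0 !scale0r !addr0.
Qed.

Lemma antilinearB H K (T : operator H K) x y :
  antilinear_op T -> dom T x -> dom T y ->
  dom T (x - y) /\ T (x - y) = T x - T y.
Proof.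
move=> [Tdom TL] Tx Ty.
have := TL 1 (-1) _ _ Tx Ty; have := dom_lin 1 (-1) Tdom Tx Ty.
by rewrite rmorphN !rmorph1 !scale1r !scaleN1r => Dxy ->.
Qed.

(** Conjugation fixes real scalars; this makes the graph a real subspace, as [closure_projection]
    requires. *)
Lemma antilinear_real H K (T : operator H K) (r : R) x y :
  antilinear_op T -> dom T x -> dom T y ->
  T (r%:C *: x + y) = r%:C *: T x + T y.
Proof.
move=> [_ TL] Tx Ty; have := TL r%:C 1 _ _ Tx Ty.
by rewrite rmorph1 !scale1r => ->; congr (_ *: _ + _); exact: conjc_real.
Qed.

Lemma comp_antilinear H K L (S : operator K L) (T : operator H K) :
  antilinear_op S -> antilinear_op T -> linear_op (comp_op S T).
Proof.
move=> [Sdom SL] [Tdom TL].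
have TS (a b : R[i]) x y : dom (comp_op S T) x -> dom (comp_op S T) y ->
    dom (comp_op S T) (a *: x + b *: y).
  move=> [Tx STx] [Ty STy]; split; first exact: dom_lin.
  by rewrite TL//; apply: dom_lin.
split.
  apply/submod_closedP; split=> [|a x y Dx Dy].
    have /submod_closedP[T0 _] := Tdom; have /submod_closedP[S0 _] := Sdom.
    by split=> //=; rewrite antilinear0.
  by rewrite -[y]scale1r; apply: TS.
by move=> a b x y [Tx STx] [Ty STy] /=; rewrite TL// SL// !conjCK.
Qed.

Lemma antiadjointE H K (A : operator H K) y : dom (antiadjoint A) y ->
  forall x, dom A x -> '[A x, y] = '[antiadjoint A y, x].
Proof. by move=> [u Pu]; exact: (xgetPex 0 (ex_intro _ u Pu)). Qed.

Lemma dense_hdot_inj H (D : set H) u v : dense D ->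
  (forall x, D x -> '[u, x] = '[v, x]) -> u = v.
Proof.
move=> Dd uv; apply/eqP; rewrite -subr_eq0; apply/eqP.
by apply: (dense_orthogonal Dd) => x Dx; rewrite linearBl /= uv ?subrr.
Qed.

Lemma antiadjoint_unique H K (A : operator H K) y u : densely_defined A ->
  (forall x, dom A x -> '[A x, y] = '[u, x]) ->
  dom (antiadjoint A) y /\ antiadjoint A y = u.
Proof.
move=> Ad Pu; have Dy : dom (antiadjoint A) y by exists u.
split=> //; apply: (dense_hdot_inj Ad) => x Dx.
by rewrite -antiadjointE// Pu.
Qed.

Lemma antiadjoint_antilinear H K (A : operator H K) :
  densely_defined A -> antilinear_op (antiadjoint A).
Proof.
move=> Ad.
have AL (a b : R[i]) x y : dom (antiadjoint A) x -> dom (antiadjoint A) y ->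
    dom (antiadjoint A) (a *: x + b *: y) /\
    antiadjoint A (a *: x + b *: y)
    = Num.conj a *: antiadjoint A x + Num.conj b *: antiadjoint A y.
  move=> Dx Dy; apply: antiadjoint_unique => // z Dz.
  rewrite linearDr linearDl !linearZr_LR !linearZl_LR /=.
  by rewrite (antiadjointE Dx Dz) (antiadjointE Dy Dz).
split; last by move=> a b x y Dx Dy; have [] := AL a b x y Dx Dy.
apply/submod_closedP; split.
  by exists 0 => x _; rewrite linear0r linear0l.
by move=> a x y Dx Dy; rewrite -[y]scale1r; have [] := AL a 1 x y Dx Dy.
Qed.

Lemma graph_decomposition H K (A : operator H K) (h : H) (k : K) :
  antilinear_op A -> densely_defined A -> closed_op A ->
  exists x w, [/\ dom A x, dom (antiadjoint A) w,
    h = x - antiadjoint A w & k = A x + w].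
Proof.
move=> Aanti Ad Ac; have [Adom AL] := Aanti.
have /submod_closedP[A0 ADL] := Adom.
have [|r u v [Du uA] [Dv vA]|q /Ac[Dq qA] pq] :=
  @closure_projection R H K [set p | dom A p.1 /\ p.2 = A p.1] (h, k).
- by split=> //=; rewrite antilinear0.
- by split; [exact: ADL | rewrite /= uA vA antilinear_real].
exists q.1, (k - A q.1).
have [Dw Ew] : dom (antiadjoint A) (k - A q.1) /\
    antiadjoint A (k - A q.1) = q.1 - h.
  apply: antiadjoint_unique => // z Dz.
  have Re0 y : dom A y -> complex.Re ('[h - q.1, y] + '[A y, k - A q.1]) = 0.
    move=> Dy; have := pq (y, A y) (conj Dy erefl).
    by rewrite /pdot /= qA (rdotC (k - _)) -ReD.
  (* Antilinearity of [A] and conjugate-linearity of the second slot release the same factor, the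
     conjugate of ['i], from both terms, so [Re0] at ['i *: z] says that the imaginary part
     vanishes. *)
  have Diz : dom A ('i *: z).
    by have := dom_lin 'i 0 Adom Dz Dz; rewrite scale0r addr0.
  have Aiz : A ('i *: z) = Num.conj 'i *: A z.
    by have := AL 'i 0 _ _ Dz Dz; rewrite rmorph0 !scale0r !addr0.
  have := Re0 _ Dz; have := Re0 _ Diz.
  rewrite Aiz linearZr_LR linearZl_LR /= -mulrDr.
  have -> : '[q.1 - h, z] = - '[h - q.1, z] by rewrite -linearNl opprB.
  case: '[h - q.1, z] => a1 a2; case: '[A z, k - A q.1] => b1 b2 /= im re.
  by apply/eqP; rewrite eq_complex /=; apply/andP; split; apply/eqP; lra.
by split=> //; rewrite ?Ew ?opprB addrC subrK.
Qed.

Lemma positive_surjective_self_adjoint H (T : operator H H) :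
  linear_op T -> positive_op T ->
  (forall x y, dom T x -> dom T y -> '[T x, y] = '[x, T y]) ->
  (forall y, exists2 x, dom T x & y = x + T x) -> self_adjoint T.
Proof.
move=> [/submod_closedP[D0 DL] TL] Tpos Tsym Tsurj.
have Tdense : densely_defined T.
  apply: dense_of_orthogonal => // y yD.
  (* Testing [y = x + T x] against [x] itself gives [rdot x x + rdot (T x) x = 0], a sum of
     nonnegative terms. *)
  have [x Dx yE] := Tsurj y.
  have T0 : T 0 = 0.
    by have := TL 0 0 0 0 D0 D0; rewrite !scale0r addr0.
  suff x0 : x = 0 by rewrite yE x0 T0 addr0.
  apply: rdot_eq0; apply/eqP; rewrite eq_le rdot_ge0 andbT.
  have := yD x Dx; rewrite yE rdotDl => /eqP; rewrite addr_eq0 => /eqP ->.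
  have := Tpos x Dx; rewrite lecE => /andP[_]; rewrite /rdot /=; lra.
split=> //; split.
  apply/seteqP; split=> y.
    (* With [u] the adjoint value at [y], symmetry gives ['[x + T x, y] = '[x, y + u] =
       '[x, v + T v] = '[x + T x, v]]; as [x + T x] is arbitrary, [y = v] lies in [dom T]. *)
    move=> [u Pu]; have [v Dv vE] := Tsurj (y + u).
    suff -> : y = v by [].
    apply: hdot_inj => z; have [x Dx ->] := Tsurj z.
    rewrite !linearDl /= Pu// Tsym// -!linearDr /= vE.
    by [].
  by move=> Dy; exists (T y) => x Dx; exact: Tsym.
move=> x Dx; have /(xgetPex 0) /= Px :
    [set u | forall z, dom T z -> '[T z, x] = '[z, u]] !=set0.
  by exists (T x) => z Dz; exact: Tsym.
apply: (dense_hdot_inj Tdense) => z Dz.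
by rewrite hdotC [in RHS]hdotC -Px// Tsym.
Qed.

End Operators.

Theorem proposition1 (R : realType) (H1 H2 : hilbertType R) (A : operator H1 H2)
    (A_antilinear : antilinear_op A) (A_dense : densely_defined A)
    (A_closed : closed_op A) :
  [/\ [/\ linear_op (comp_op (antiadjoint A) A),
          self_adjoint (comp_op (antiadjoint A) A)
        & positive_op (comp_op (antiadjoint A) A)],
      [/\ linear_op (comp_op A (antiadjoint A)),
          self_adjoint (comp_op A (antiadjoint A))
        & positive_op (comp_op A (antiadjoint A))]
    & core A (dom (comp_op (antiadjoint A) A))].
Proof.
have B_antilinear := antiadjoint_antilinear A_dense.
have lin1 := comp_antilinear B_antilinear A_antilinear.
have lin2 := comp_antilinear A_antilinear B_antilinear.
have pos1 : positive_op (comp_op (antiadjoint A) A).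
  by move=> x [Dx DAx]; rewrite /= -antiadjointE// dnorm_ge0.
have pos2 : positive_op (comp_op A (antiadjoint A)).
  by move=> y [Dy DBy]; rewrite /= antiadjointE// dnorm_ge0.
have surj1 h : exists2 x, dom (comp_op (antiadjoint A) A) x &
    h = x + comp_op (antiadjoint A) A x.
  (* Here [w = - A x], and additivity of the adjoint turns [h = x - antiadjoint A w] into the
     claim. *)
  have [x [w [Dx Dw hE /eqP]]] :=
    graph_decomposition h 0 A_antilinear A_dense A_closed.
  rewrite eq_sym addr_eq0 => /eqP Ax.
  have B0 : dom (antiadjoint A) 0 by have [/submod_closedP[]] := B_antilinear.
  have [] := antilinearB B_antilinear B0 Dw.
  rewrite (antilinear0 B_antilinear) !sub0r -Ax => DAx BAx.
  by exists x; [split | rewrite hE -BAx].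
have surj2 k : exists2 y, dom (comp_op A (antiadjoint A)) y &
    k = y + comp_op A (antiadjoint A) y.
  have [x [w [Dx Dw /eqP hE kE]]] :=
    graph_decomposition 0 k A_antilinear A_dense A_closed.
  move: hE; rewrite eq_sym subr_eq0 => /eqP xE.
  by exists w; [split; rewrite -?xE | rewrite kE addrC xE].
split.
- split=> //; apply: positive_surjective_self_adjoint => //.
  (* The antilinear adjoint relation swaps the arguments, so both sides equal ['[A y, A x]]. *)
  move=> x y [Dx DAx] [Dy DAy]; apply: etrans (esym (antiadjointE DAx Dy)) _.
  by rewrite hdotC (antiadjointE DAy Dx) -hdotC.
- split=> //; apply: positive_surjective_self_adjoint => //.
  move=> x y [Dx DBx] [Dy DBy]; apply: etrans (antiadjointE Dy DBx) _.
  by rewrite hdotC -(antiadjointE Dx DBy) -hdotC.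
split; [by case: lin1 | by move=> x [] |].
move=> x Dx e e0.
pose M := [set p : H1 * H2 | dom (comp_op (antiadjoint A) A) p.1 /\ p.2 = A p.1].
have /submod_closedP[D0 DL] := lin1.1.
have [|r u v [Du uA] [Dv vA]|q qM pq] :=
  @closure_projection R H1 H2 M (x, A x).
- by split; rewrite //= antilinear0.
- split; first exact: DL.
  by case: Du Dv => Du _ [Dv _]; rewrite /= uA vA antilinear_real.
(* [M] lies in the closed graph of [A], hence so does its closure. *)
have [Dq qA] : dom A q.1 /\ q.2 = A q.1.
  by apply: A_closed; apply: closure_subset qM => -[u v] [[]].
have [Dz zA] := antilinearB A_antilinear Dx Dq.
have xq : (x, A x) = q.
  (* For this [v], the squared norm of [x - q.1] is the product of [(x, A x) - q] with [(v, A v)], a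
     point of [M]. *)
  have [v Dv zv] := surj1 (x - q.1).
  have /eqP : x - q.1 = 0.
    apply: rdot_eq0; rewrite {1}zv rdotDl -(pq (v, A v) (conj Dv erefl)).
    rewrite /pdot /= qA -zA rdotC; congr (_ + _).
    by case: Dv => Dv DAv; rewrite /rdot antiadjointE.
  by rewrite subr_eq0 [RHS]surjective_pairing qA => /eqP ->.
have eE : e = (complex.Re e)%:C by rewrite RRe_real// gtr0_real.
have r0 : 0 < complex.Re e by rewrite -ltcR -eE.
rewrite -xq in qM.
(* Radius [e / 2] in each coordinate keeps the squared graph norm below [e ^+ 2 / 2]. *)
have [|[y y'] [[/= Dy ->]]] := qM (ball (x, A x) (complex.Re e / 2)%:C).
  by apply: nbhsx_ballx; rewrite ltcR; lra.
move=> -[]; rewrite -!ball_normE /= => /norm_lt_rdot xy /norm_lt_rdot Axy.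
exists y => //; rewrite /graph_norm.
have [_ ->] := antilinearB A_antilinear Dx (proj1 Dy).
rewrite !norm_sqr_rdot -rmorphD [ltRHS]eE.
rewrite -(@ltr_pXn2r _ 2)// ?nnegrE ?sqrtC_ge0 ?ler0c ?addr_ge0 ?rdot_ge0 ?ltW//.
rewrite sqrtCK -rmorphXn ltcR /=; nra.
Qed.
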